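(* Let $(G,g,Q)$ be the manifold described in the context, with Lie algebra given by $$\begin{aligned} [x_{1}, x_{2}]&=\lambda_{1}x_{1}+\lambda_{2}x_{2}+\lambda_{3}x_{3},\\ [x_{2}, x_{3}]&=\nu_{1}x_{1}+\nu_{2}x_{2}+\nu_{3}x_{3},\\ [x_{1}, x_{3}]&=(\nu_{2}+\lambda_{3})x_{1}+(\nu_{3}+\lambda_{1})x_{2}+(\nu_{1}+\lambda_{2})x_{3}, \end{aligned}$$ where $$\begin{aligned} 2\nu_{1}\lambda_{2}+\nu^{2}_{1}-\lambda_{1}\nu_{2}-\nu_{2}\nu_{3}-\lambda_{3}\nu_{3}&=0,\\ 2\nu_{2}\lambda_{3}+\lambda^{2}_{3}-\lambda_{2}\nu_{3}-\lambda_{1}\lambda_{2}-\lambda_{1}\nu_{1}&=0,\\ -\lambda^{2}_{1}+\nu^{2}_{3}+\lambda_{2}\lambda_{3}-\nu_{1}\nu_{2}&=0. \end{aligned}$$ Then the components of $R$, $F$, $\theta$, $\theta^{*}$ with respect to $\{x_i\}$ are as follows (the remaining components of $R$ and $F$ being determined by the curvature symmetries and by $F_{ijk}=F_{ikj}$). Curvature: $$\begin{aligned} R_{1212}&=-\tfrac14(\lambda_{1}+ \nu_{1}+\nu_{3})^{2}+\tfrac34\lambda^{2}_{3}+\lambda^{2}_{1}+\lambda^{2}_{2}+\nu_{2}\lambda_{3}+\nu^{2}_{2}+\tfrac12\lambda_{1}\lambda_{3}+\tfrac12\nu_{3}\lambda_{3}-\tfrac12\lambda_{3}\nu_{1},\\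 R_{1313}&=\tfrac34(\lambda_{1}+\nu_{3})^{2}-\tfrac14(\lambda_{3}-\nu_{1})^{2}+(\lambda_{3}+\nu_{2})^{2}+(\lambda_{2}+\nu_{1})^{2}+\tfrac12(\lambda_{1}+\nu_{3})(\nu_{1}+\lambda_{3})-\lambda_{1}\nu_{3},\\ R_{2323}&=-\tfrac14\lambda^{2}_{1}+\lambda^{2}_{2}-\tfrac14\lambda^{2}_{3}+\tfrac34\nu_{1}^{2}+\nu^{2}_{2}+\tfrac34\nu_{3}^{2}+\tfrac12\lambda_{1}(-\nu_{3}+\nu_{1}-\lambda_{3})-\tfrac12\lambda_{3}\nu_{3}+\lambda_{2}\nu_{1}-\tfrac12\nu_{1}\lambda_{3}+\tfrac12\nu_{1}\nu_{3},\\ R_{1223}&=-\lambda_{2}\lambda_{3}+\lambda_{1}\nu_{1}+\lambda^{2}_{1}+\lambda_{1}\nu_{3}+\lambda_{3}\nu_{3},\\ R_{1213}&=\lambda_{2}(\lambda_{1}+\nu_{1}+\nu_{3})+\lambda_{3}(\lambda_{1}+\lambda_{2}+\nu_{1}),\\ R_{1332}&=-\lambda_{1}\nu_{2}-\nu_{2}\nu_{3}-\lambda_{3}\nu_{1}-\nu_{2}\lambda_{3}-\nu_{1}\nu_{3}-\nu_{2}\nu_{1}. \end{aligned}$$ Tensor $F$: $$\begin{aligned} F_{111}&=2\lambda_{1}+2\lambda_{3}+2\nu_{2},\qquad F_{222}=-2\lambda_{2}+2\nu_{2},\qquad F_{333}=-2\lambda_{2}-2\nu_{1}-2\nu_{3},\\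 F_{112}&=F_{221}=\tfrac12(\lambda_{1}+\lambda_{3}+\nu_{1}+2\nu_{2}+\nu_{3}),\\ F_{113}&=F_{331}=\tfrac12(\lambda_{1}+\lambda_{3}-\nu_{1}-\nu_{3}),\\ F_{223}&=F_{332}=-\tfrac12(\lambda_{1}+2\lambda_{2}+\lambda_{3}+\nu_{1}+\nu_{3}),\\ F_{211}&=F_{311}=\lambda_{1}+2\lambda_{2}+\lambda_{3}+\nu_{1}+\nu_{3},\\ F_{122}&=F_{322}=-\lambda_{1}-\lambda_{3}+\nu_{1}+\nu_{3},\\ F_{133}&=F_{233}=-\lambda_{1}-\lambda_{3}-\nu_{1}-2\nu_{2}-\nu_{3},\\ F_{123}&=-\lambda_{1}-\lambda_{3}-\nu_{2},\qquad F_{213}=\lambda_{2}-\nu_{2},\qquad F_{312}=\lambda_{2}+\nu_{1}+\nu_{3}. \end{aligned}$$ Lee forms: $$\begin{aligned} \theta_{1}&=3(\lambda_{1}+\lambda_{3}+\nu_{2}),\quad \theta_{2}=3(\nu_{2}-\lambda_{2}),\quad \theta_{3}=-3(\lambda_{2}+\nu_{1}+\nu_{3}),\\ \theta^{*}_{1}&=\tfrac32(\lambda_{1}+2\lambda_{2}+\lambda_{3}+\nu_{1}+\nu_{3}),\quad \theta^{*}_{2}=-\tfrac32(\lambda_{1}+\lambda_{3}-\nu_{1}-\nu_{3}),\\ \theta^{*}_{3}&=-\tfrac32(\lambda_{1}+\lambda_{3}+\nu_{1}+2\nu_{2}+\nu_{3}). \end{aligned}$$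
   Context: $G$ is a $3$-dimensional real connected Lie group whose Lie algebra has a basis $\{x_1,x_2,x_3\}$ of left invariant vector fields; $Q$ and $g$ are the left invariant $(1,1)$-tensor field and Riemannian metric with $Qx_1=x_2$, $Qx_2=x_3$, $Qx_3=x_1$ and $g(x_i,x_j)=\delta_{ij}$. The associated metric is $\tilde g(x,y)=g(x,Qy)+g(Qx,y)$, so $\tilde g(x_i,x_j)=1$ for $i\ne j$ and $0$ for $i=j$. $\nabla$ is the Levi-Civita connection of $g$. $R(x,y)z=\nabla_x\nabla_yz-\nabla_y\nabla_xz-\nabla_{[x,y]}z$, $R(x,y,z,u)=g(R(x,y)z,u)$, $R_{ijkl}=R(x_i,x_j,x_k,x_l)$. $F(x,y,z)=(\nabla_x\tilde g)(y,z)$, $F_{ijk}=F(x_i,x_j,x_k)$. $\theta_k=\sum_i F(x_i,x_i,x_k)$ and $\theta^{*}_k=\sum_i F(x_i,Qx_i,x_k)$. *)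

(* Defs.v *)
From HB Require Import structures.
From mathcomp Require Import all_boot all_order all_algebra.
From mathcomp Require Import all_classical all_reals all_analysis.

Set Implicit Arguments.
Unset Strict Implicit.
Unset Printing Implicit Defensive.

Import Order.TTheory GRing.Theory Num.Theory.
Import numFieldNormedType.Exports.

Local Open Scope classical_set_scope.
Local Open Scope ring_scope.

(* On an open subset U of a finite-dimensional space, f is C^(k+1) iff it is
   continuous and its directional derivatives exist and are C^k. *)
Fixpoint Ck (R : realType) (V W : normedModType R) (k : nat)
    (U : set V) (f : V -> W) : Prop :=
  (forall u, U u -> {for u, continuous f}) /\
  if k is k'.+1 then
    forall v, (forall u, U u -> derivable f u v) /\
              Ck k' U (fun u => 'D_v f u)
  else True.

Definition smooth_on (R : realType) (V W : normedModType R)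
    (U : set V) (f : V -> W) : Prop := forall k, Ck k U f.

(* phi and psi are total functions: they are meaningful only on dom and img. *)
Record chart (R : realType) (n : nat) (M : topologicalType) := Chart {
  dom : set M;
  img : set 'rV[R]_n;
  phi : M -> 'rV[R]_n;
  psi : 'rV[R]_n -> M;
  dom_open : open dom;
  img_open : open img;
  phi_img : forall p, dom p -> img (phi p);
  psi_dom : forall u, img u -> dom (psi u);
  phiK : forall p, dom p -> psi (phi p) = p;
  psiK : forall u, img u -> phi (psi u) = u;
  phi_cont : forall p, dom p -> {for p, continuous phi};
  psi_cont : forall u, img u -> {for u, continuous psi}
}.

HB.mixin Record isManifold (R : realType) (n : nat) M of Topological M := {
  atlas : set (chart R n M);
  chart_at : M -> chart R n M;
  manifold_hausdorff : hausdorff_space M;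
  manifold_second_countable : @second_countable M;
  chart_at_atlas : forall p, atlas (chart_at p);
  dom_chart_at : forall p, dom (chart_at p) p;
  atlas_compatible : forall c d, atlas c -> atlas d ->
    smooth_on [set u | img c u /\ dom d (psi c u)]
              (fun u : 'rV[R]_n => phi d (psi c u))
}.

#[short(type="manifoldType")]
HB.structure Definition Manifold (R : realType) (n : nat) :=
  {M of isManifold R n M & Topological M}.

Section Manifold.
Context {R : realType} {n : nat} {M : manifoldType R n}.

(* The tangent space at p is 'rV[R]_n, a tangent vector being given by its
   components in the preferred chart [chart_at p]. *)
Definition vfield := M -> 'rV[R]_n.

Definition smooth_fun (f : M -> R) : Prop :=
  forall c : chart R n M, atlas c -> smooth_on (img c) (f \o psi c : _ -> R^o).

Definition dfun (f : M -> R) (p : M) (v : 'rV[R]_n) : R :=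
  'D_v (f \o psi (chart_at p) : _ -> R^o) (phi (chart_at p) p).

(* components in the chart c of the tangent vector v at p *)
Definition in_chart (c : chart R n M) (p : M) (v : 'rV[R]_n) : 'rV[R]_n :=
  'D_v (phi c \o psi (chart_at p)) (phi (chart_at p) p).

Definition local_rep (c : chart R n M) (X : vfield) (u : 'rV[R]_n) : 'rV[R]_n :=
  in_chart c (psi c u) (X (psi c u)).

Definition smooth_vfield (X : vfield) : Prop :=
  forall c : chart R n M, atlas c -> smooth_on (img c) (local_rep c X).

Definition apply_vfield (X : vfield) (f : M -> R) : M -> R :=
  fun p => dfun f p (X p).

(* [X, Y]^k = X(Y^k) - Y(X^k) in the chart [chart_at p], so that
   [X, Y] f = X (Y f) - Y (X f) *)
Definition lie_bracket (X Y : vfield) : vfield := fun p =>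
  let c := chart_at p in
  'D_(X p) (local_rep c Y) (phi c p) - 'D_(Y p) (local_rep c X) (phi c p).

Definition scale_vfield (f : M -> R) (X : vfield) : vfield :=
  fun p => f p *: X p.

Definition tensor11 := M -> 'rV[R]_n -> 'rV[R]_n.
Definition tensor02 := M -> 'rV[R]_n -> 'rV[R]_n -> R.

Definition app11 (Q : tensor11) (X : vfield) : vfield := fun p => Q p (X p).
Definition app02 (h : tensor02) (X Y : vfield) : M -> R :=
  fun p => h p (X p) (Y p).

Record is_tensor11 (Q : tensor11) : Prop := {
  tensor11_linear : forall p a v w, Q p (a *: v + w) = a *: Q p v + Q p w;
  tensor11_smooth : forall X,
    smooth_vfield X -> smooth_vfield (app11 Q X)
}.

Record is_riemannian (g : tensor02) : Prop := {
  metric_linear : forall p a u v w,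
    g p (a *: u + v) w = a * g p u w + g p v w;
  metric_sym : forall p v w, g p v w = g p w v;
  metric_pos : forall p v, v != 0 -> 0 < g p v v;
  metric_smooth : forall X Y,
    smooth_vfield X -> smooth_vfield Y -> smooth_fun (app02 g X Y)
}.

Definition connection := vfield -> vfield -> vfield.

Record is_connection (nabla : connection) : Prop := {
  connection_smooth : forall X Y,
    smooth_vfield X -> smooth_vfield Y -> smooth_vfield (nabla X Y);
  connectionDl : forall X X' Y,
    smooth_vfield X -> smooth_vfield X' -> smooth_vfield Y ->
    nabla (X + X') Y = nabla X Y + nabla X' Y;
  connectionZl : forall f X Y,
    smooth_fun f -> smooth_vfield X -> smooth_vfield Y ->
    nabla (scale_vfield f X) Y = scale_vfield f (nabla X Y);
  connectionDr : forall X Y Y',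
    smooth_vfield X -> smooth_vfield Y -> smooth_vfield Y' ->
    nabla X (Y + Y') = nabla X Y + nabla X Y';
  connection_leibniz : forall f X Y,
    smooth_fun f -> smooth_vfield X -> smooth_vfield Y ->
    nabla X (scale_vfield f Y) =
    scale_vfield (apply_vfield X f) Y + scale_vfield f (nabla X Y)
}.

Record is_levi_civita (g : tensor02) (nabla : connection) : Prop := {
  levi_civita_connection : is_connection nabla;
  levi_civita_torsion_free : forall X Y,
    smooth_vfield X -> smooth_vfield Y ->
    nabla X Y - nabla Y X = lie_bracket X Y;
  levi_civita_metric : forall X Y Z,
    smooth_vfield X -> smooth_vfield Y -> smooth_vfield Z ->
    apply_vfield X (app02 g Y Z) =
    app02 g (nabla X Y) Z + app02 g Y (nabla X Z)
}.

Definition curvature (nabla : connection) (X Y Z : vfield) : vfield :=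
  nabla X (nabla Y Z) - nabla Y (nabla X Z) - nabla (lie_bracket X Y) Z.

Definition curvature04 (g : tensor02) (nabla : connection)
    (X Y Z U : vfield) : M -> R :=
  app02 g (curvature nabla X Y Z) U.

(* (nabla_X h)(Y, Z) *)
Definition cov_deriv (nabla : connection) (h : tensor02)
    (X Y Z : vfield) : M -> R :=
  apply_vfield X (app02 h Y Z)
    - app02 h (nabla X Y) Z - app02 h Y (nabla X Z).

Definition assoc_metric (g : tensor02) (Q : tensor11) : tensor02 :=
  fun p v w => g p v (Q p w) + g p (Q p v) w.

Definition F_tensor (g : tensor02) (Q : tensor11) (nabla : connection)
    (X Y Z : vfield) : M -> R :=
  cov_deriv nabla (assoc_metric g Q) X Y Z.

(* The traces defining the Lee forms are taken over the frame x, which has to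
   be g-orthonormal. *)
Definition lee_theta (g : tensor02) (Q : tensor11) (nabla : connection)
    (x : 'I_n -> vfield) (Z : vfield) : M -> R :=
  fun p => \sum_i F_tensor g Q nabla (x i) (x i) Z p.

Definition lee_theta_star (g : tensor02) (Q : tensor11) (nabla : connection)
    (x : 'I_n -> vfield) (Z : vfield) : M -> R :=
  fun p => \sum_i F_tensor g Q nabla (x i) (app11 Q (x i)) Z p.

Definition dmap (f : M -> M) (p : M) (v : 'rV[R]_n) : 'rV[R]_n :=
  'D_v (phi (chart_at (f p)) \o f \o psi (chart_at p)) (phi (chart_at p) p).

Definition smooth_map (f : M -> M) : Prop :=
  continuous f /\
  forall c d : chart R n M, atlas c -> atlas d ->
    smooth_on [set u | img c u /\ dom d (f (psi c u))]
              (fun u : 'rV[R]_n => phi d (f (psi c u))).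

Definition smooth_map2 (f : M -> M -> M) : Prop :=
  continuous (fun pq : M * M => f pq.1 pq.2) /\
  forall c d e : chart R n M, atlas c -> atlas d -> atlas e ->
    smooth_on
      [set u | [/\ img c u.1, img d u.2 & dom e (f (psi c u.1) (psi d u.2))]]
      (fun u : 'rV[R]_n * 'rV[R]_n => phi e (f (psi c u.1) (psi d u.2))).

End Manifold.

Arguments vfield {R n} M.
Arguments tensor11 {R n} M.
Arguments tensor02 {R n} M.
Arguments connection {R n} M.

HB.mixin Record isLieGroup (R : realType) (n : nat) G
    of Manifold R n G & Group G := {
  mulg_smooth : smooth_map2 (fun a b : G => (a * b)%g);
  invg_smooth : smooth_map (fun a : G => (a^-1)%g)
}.

#[short(type="lieGroupType")]
HB.structure Definition LieGroup (R : realType) (n : nat) :=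
  {G of isLieGroup R n G & Manifold R n G & Group G}.

Section LieGroup.
Context {R : realType} {n : nat} {G : lieGroupType R n}.

Definition left_translation (a : G) : G -> G := fun p => (a * p)%g.

Definition left_invariant_vfield (X : vfield G) : Prop :=
  smooth_vfield X /\
  forall a p, dmap (left_translation a) p (X p) = X (left_translation a p).

Definition left_invariant11 (Q : tensor11 G) : Prop :=
  forall a p v, dmap (left_translation a) p (Q p v) =
                Q (left_translation a p) (dmap (left_translation a) p v).

Definition left_invariant02 (h : tensor02 G) : Prop :=
  forall a p v w, h (left_translation a p) (dmap (left_translation a) p v)
                    (dmap (left_translation a) p w) = h p v w.

Definition lie_algebra_basis (m : nat) (x : 'I_m -> vfield G) : Prop :=
  (forall i, left_invariant_vfield (x i)) /\
  forall X, left_invariant_vfield X ->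
    exists! a : 'rV[R]_m, X = \sum_i a 0 i *: x i.

End LieGroup.

(* the indices 1, 2, 3 *)
Definition i1 : 'I_3 := @Ordinal 3 0 isT.
Definition i2 : 'I_3 := @Ordinal 3 1 isT.
Definition i3 : 'I_3 := @Ordinal 3 2 isT.

(* Main.v *)
Require Import Defs.
From HB Require Import structures.
From mathcomp Require Import all_boot all_order all_algebra.
From mathcomp Require Import all_classical all_reals all_analysis.
From mathcomp Require Import ring lra.

Set Implicit Arguments.
Unset Strict Implicit.
Unset Printing Implicit Defensive.

Import Order.TTheory GRing.Theory Num.Theory.
Import numFieldNormedType.Exports.

Local Open Scope classical_set_scope.
Local Open Scope ring_scope.

(** The frame [x] is orthonormal for [g] and its brackets have constant
coefficients [c i j k], so all the tensors at stake have constant components,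
and these are polynomials in the structure constants.

Koszul's formula gives the connection.  Differentiating the constants
[g (x j) (x k)] shows that [g (nabla_(x i) (x j)) (x k)] is skew in [j], [k];
its part skew in [i], [j] is [c i j k] because the torsion vanishes; and a
three-index array which is skew in its last two indices is determined by its
part skew in the first two.  Hence these components are the constants
[christoffel c i j k] ([levi_civita_frame]).

For the curvature, one differentiates the constant
[g (nabla_(x j) (x k)) (x l)] along [x i]: compatibility with the metric turns
[g (nabla_(x i) (nabla_(x j) (x k))) (x l)] into a contraction of two
Christoffel arrays ([curvature_frame]).  Likewise the associated metric is
constant on the frame, being 1 off the diagonal and 0 on it, and [F] is a
contraction of the Christoffel array with it ([cov_deriv_frame]).  The
formulas are then polynomial identities in the six parameters.  The three
quadratic relations are the Jacobi identity; they are what makes the curvature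
symmetric under exchange of its two pairs of indices.

One analytic point needs care.  Expanding [nabla] along a bracket
[[x i, x j] = \sum_k c i j k *: x k] requires linear combinations of smooth
fields to be smooth, whereas smoothness is expressed by iterated directional
derivatives and the components of a tangent vector in a chart are a directional
derivative of a transition map.  What is needed is that a directional
derivative is additive in the direction; for a function with continuous
directional derivatives this follows from the mean value theorem
([is_derive_addv]). *)

(** * Directional derivatives as functions of the direction *)

Lemma is_derive_scalev (R : realType) (V W : normedModType R) (f : V -> W)
    (a v : V) (c : R) :
  derivable f a v -> is_derive a (c *: v) f (c *: 'D_v f a).
Proof.
move=> dfv; have [->|c0] := eqVneq c 0.
  by rewrite !scale0r; exact: is_derive0.
suff H : h^-1 *: ((f \o shift a) (h *: (c *: v)) - f a) @[h --> 0^'] -->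
    c *: 'D_v f a.
  by split; [exact: cvgP H | exact: cvg_lim H].
have scale0 : (fun h => c * h) h @[h --> 0^'] --> 0^'.
  move=> A /nbhs_ballP[e /= e0 eA]; apply/nbhs_ballP.
  exists (e / `|c|) => /=; first by rewrite divr_gt0 ?normr_gt0.
  move=> h; rewrite -ball_normE /= sub0r normrN ltr_pdivlMr ?normr_gt0// => hc h0.
  apply: eA; last by rewrite mulf_neq0.
  by rewrite -ball_normE /= sub0r normrN normrM mulrC.
have H : c *: ((c * h)^-1 *: ((f \o shift a) ((c * h) *: v) - f a)) @[h --> 0^']
    --> c *: 'D_v f a.
  apply: cvgZl_tmp; exact: (cvg_comp _ _ scale0 dfv).
apply: cvg_trans H; apply: near_eq_cvg; near=> h.
by rewrite scalerA invfM mulrA mulfV// mul1r !scalerA [h * c]mulrC.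
Unshelve. all: by end_near. Qed.

(** Going from [a] to [a + h *: (v + w)] in two steps, along [v] and then along
[w], the second increment is [h] times a value of ['D_w f] at a point near [a],
by the mean value theorem. *)
Lemma is_derive_addv (R : realType) (V : normedModType R) (f : V -> R^o)
    (a v w : V) :
  derivable f a v -> (\forall u \near a, derivable f u w) ->
  {for a, continuous ('D_w f)} ->
  is_derive a (v + w) f ('D_v f a + 'D_w f a).
Proof.
move=> dv dw cw.
have line (b : V) (h s : R) : derivable f (s *: (h *: w) + b) w ->
    is_derive s 1 (fun s : R => f (s *: (h *: w) + b) : R^o)
      (h *: 'D_w f (s *: (h *: w) + b)).
  move=> /(is_derive_scalev h) [D E].
  have EQ : (fun k => k^-1 *:
      (((fun s : R => f (s *: (h *: w) + b) : R^o) \o shift s) (k *: 1)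
       - f (s *: (h *: w) + b))) =
     (fun k => k^-1 *: ((f \o shift (s *: (h *: w) + b)) (k *: (h *: w))
       - f (s *: (h *: w) + b))).
    apply/funext => k /=; congr (_ *: (f _ - _)).
    by rewrite [k *: 1]mulr1 scalerDl addrA.
  split; first by rewrite /derivable EQ.
  by rewrite /derive EQ.
suff H : h^-1 *: ((f \o shift a) (h *: (v + w)) - f a) @[h --> 0^'] -->
    'D_v f a + 'D_w f a.
  by split; [exact: cvgP H | exact: cvg_lim H].
(* The first summand tends to ['D_v f a], the second is the object of the mean
   value theorem. *)
have -> : (fun h => h^-1 *: ((f \o shift a) (h *: (v + w)) - f a)) =
  (fun h => h^-1 *: ((f \o shift a) (h *: v) - f a)
     + h^-1 *: (f (h *: w + (h *: v + a)) - f (h *: v + a))).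
  apply/funext => h /=; rewrite -scalerDr; congr (_ *: _).
  by rewrite [RHS]addrC addrA subrK scalerDr addrCA addrA.
apply: cvgD; first exact: dv.
apply/cvgrPdist_le => e e0.
have /nbhs_ballP[d /= d0 dH] : \forall u \near a,
    derivable f u w /\ `|'D_w f a - 'D_w f u| <= e.
  near=> u; split; first by near: u.
  by near: u; exact: ((cvgrPdist_le _ _).1 cw e e0).
have small : \forall h \near (0 : R), `|h| * (`|v| + `|w|) < d.
  have C : `|h| * (`|v| + `|w|) @[h --> (0 : R)] --> 0.
    rewrite -[X in _ --> X](mul0r (`|v| + `|w|)) -[X in X * _](@normr0 _ R).
    by apply: cvgMr_tmp; apply: cvg_norm; exact: cvg_id.
  exact: (cvgr_lt 0 C).
have : \forall h \near (0 : R)^', h != 0 /\ `|h| * (`|v| + `|w|) < d.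
  near=> h; split; first by near: h; exact: nbhs_dnbhs_neq.
  near: h; exact: nbhs_dnbhs.
apply: filterS => h [h0 hd].
have inball s : 0 <= s <= 1 -> derivable f (s *: (h *: w) + (h *: v + a)) w /\
    `|'D_w f a - 'D_w f (s *: (h *: w) + (h *: v + a))| <= e.
  move=> /andP[s0 s1]; apply: dH; rewrite -ball_normE /=.
  rewrite addrA opprD addrCA subrr addr0 normrN (le_lt_trans _ hd)//.
  rewrite (le_trans (ler_normD _ _))// mulrDr addrC lerD ?normrZ//.
  by rewrite (ger0_norm s0) ler_piMl// mulr_ge0.
pose phi s : R^o := f (s *: (h *: w) + (h *: v + a)).
have [|||c c01] := @MVT _ phi
  (fun s => h *: 'D_w f (s *: (h *: w) + (h *: v + a))) 0 1.
- exact: ltr01.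
- move=> s; rewrite in_itv /= => /andP[s0 s1]; apply: line.
  by apply: (inball s _).1; rewrite !ltW.
- apply: derivable_within_continuous => s; rewrite in_itv /= => s01.
  by have [] := line (h *: v + a) h s (inball s s01).1.
rewrite subr0 mulr1 /phi scale1r scale0r add0r => ->.
rewrite scalerK ?unitfE//; apply: (inball c _).2.
by move: c01; rewrite in_itv /= => /andP[s0 s1]; rewrite !ltW.
Unshelve. all: by end_near. Qed.

Lemma near_eq_continuous_at (S T : topologicalType) (f g : S -> T) (a : S) :
  (\forall u \near a, f u = g u) -> {for a, continuous f} ->
  {for a, continuous g}.
Proof.
move=> fg cf; rewrite /prop_for /continuous_at -(nbhs_singleton fg).
by apply: cvg_trans cf; exact: near_eq_cvg.
Qed.

Lemma derive_coord (R : realType) (V : normedModType R) (m n : nat)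
    (f : V -> 'M[R]_(m, n)) (a v : V) i j :
  derivable f a v -> 'D_v f a i j = 'D_v (fun u => f u i j : R^o) a.
Proof. by move=> df; rewrite [in LHS](derive_mx df) mxE. Qed.

Lemma is_derive_addv_mx (R : realType) (V : normedModType R) (m n : nat)
    (f : V -> 'M[R]_(m, n)) (a v w : V) :
  derivable f a v -> (\forall u \near a, derivable f u w) ->
  {for a, continuous ('D_w f)} ->
  is_derive a (v + w) f ('D_v f a + 'D_w f a).
Proof.
move=> dv dw cw.
have Ef i j : is_derive a (v + w) (fun u => f u i j : R^o)
    ('D_v f a i j + 'D_w f a i j).
  have dwij : \forall u \near a, 'D_w f u i j = 'D_w (fun u => f u i j : R^o) u.
    by apply: filterS dw => u; exact: derive_coord.
  rewrite (derive_coord _ _ dv) (nbhs_singleton dwij); apply: is_derive_addv.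
  - exact: (derivable_mxP _ _ _).1 dv i j.
  - by apply: filterS dw => u du; exact: (derivable_mxP _ _ _).1 du i j.
  - apply: near_eq_continuous_at dwij _.
    exact: (cvg_comp _ _ cw (@coord_continuous _ _ _ i j _)).
have dvw : derivable f a (v + w).
  by apply/derivable_mxP => i j; have [] := Ef i j.
split=> //; apply/matrixP => i j; rewrite (derive_coord _ _ dvw) [RHS]mxE.
exact: derive_val.
Qed.

(** * Closure properties of C^k maps *)

Section Ck.
Context {R : realType} {V W : normedModType R}.
Implicit Types (U : set V) (f g : V -> W).

Lemma Ck_ext k U f g : open U -> (forall u, U u -> f u = g u) ->
  Ck k U f -> Ck k U g.
Proof.
move=> Uo; elim: k f g => [|k IH] f g fg.
  move=> [cf _]; split=> // u Uu; apply: near_eq_continuous_at (cf _ Uu).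
  by apply: filterS (open_nbhs_nbhs (conj Uo Uu)) => ?; exact: fg.
move=> [cf df].
have nfg u : U u -> \forall u' \near u, f u' = g u'.
  by move=> Uu; apply: filterS (open_nbhs_nbhs (conj Uo Uu)) => ?; exact: fg.
split=> [u Uu|v]; first exact: near_eq_continuous_at (nfg _ Uu) (cf _ Uu).
have [dfv Cf] := df v; split=> [u Uu|].
  by apply: near_eq_derivable (dfv _ Uu); exact: nfg.
by apply: IH Cf => u Uu; apply: near_eq_derive; exact: nfg.
Qed.

Lemma CkD k U f g : open U -> Ck k U f -> Ck k U g -> Ck k U (f + g).
Proof.
move=> Uo; elim: k f g => [|k IH] f g [cf df] [cg dg].
  by split=> // u Uu; apply: cvgD; [exact: cf | exact: cg].
split=> [u Uu|v]; first by apply: cvgD; [exact: cf | exact: cg].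
have [dfv Cf] := df v; have [dgv Cg] := dg v; split=> [u Uu|].
  by apply: derivableD; [exact: dfv | exact: dgv].
apply: (Ck_ext Uo) (IH _ _ Cf Cg) => u Uu /=.
by rewrite deriveD //; [exact: dfv | exact: dgv].
Qed.

Lemma CkZ k U (a : R) f : open U -> Ck k U f -> Ck k U (a \*: f).
Proof.
move=> Uo; elim: k f => [|k IH] f [cf df].
  by split=> // u Uu; apply: cvgZl_tmp; exact: cf.
split=> [u Uu|v]; first by apply: cvgZl_tmp; exact: cf.
have [dfv Cf] := df v; split=> [u Uu|].
  by apply: derivableZ; exact: dfv.
apply: (Ck_ext Uo) (IH _ Cf) => u Uu /=.
by rewrite deriveZ //; exact: dfv.
Qed.

Lemma Ck_cst k U (b : W) : Ck k U (fun=> b).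
Proof.
elim: k b => [|k IH] b; first by split=> // u _; exact: cvg_cst.
split=> [u _|v]; first exact: cvg_cst.
split=> [u _|]; first exact: derivable_cst.
have -> : 'D_v (fun=> b : W) = (fun=> 0) by apply/funext => u; exact: derive_cst.
exact: IH.
Qed.

End Ck.

(** * Linear combinations of smooth vector fields *)

Section SmoothFields.
Context {R : realType} {n : nat} {M : manifoldType R n}.
Implicit Types (c : chart R n M) (X Y : vfield M) (p : M).

Section Transition.
Variables (c : chart R n M) (p : M).
Hypotheses (catl : atlas c) (cp : dom c p).
Let d : chart R n M := chart_at p.
Let transition := phi c \o psi d.

(** Charts are compatible only over the intersection of their domains, which
contains a neighbourhood of [p] since [psi d] is continuous. *)
Let transition_C1 (v : 'rV[R]_n) :
  (\forall u \near phi d p, derivable transition u v) /\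
  {for phi d p, continuous ('D_v transition)}.
Proof.
have := atlas_compatible _ _ (chart_at_atlas p) catl 1%N.
move=> -[_ /(_ v)[dv [cv _]]].
have dp : dom d p by exact: dom_chart_at.
split; last by apply: cv; split; [exact: phi_img | rewrite phiK].
have Ud : \forall u \near phi d p, img d u.
  by apply: open_nbhs_nbhs; split; [exact: img_open | exact: phi_img].
have Uc : \forall u \near phi d p, dom c (psi d u).
  apply: (psi_cont (phi_img dp)); rewrite phiK//.
  by apply: open_nbhs_nbhs; split => //; exact: dom_open.
by near=> u; apply: dv; split; near: u.
Unshelve. all: by end_near. Qed.

Lemma in_chartD v w : in_chart c p (v + w) = in_chart c p v + in_chart c p w.
Proof.
rewrite /in_chart; apply: derive_val; apply: is_derive_addv_mx.
- exact: nbhs_singleton (transition_C1 v).1.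
- exact: (transition_C1 w).1.
- exact: (transition_C1 w).2.
Qed.

Lemma in_chartZ a v : in_chart c p (a *: v) = a *: in_chart c p v.
Proof.
rewrite /in_chart; apply: derive_val; apply: is_derive_scalev.
exact: nbhs_singleton (transition_C1 v).1.
Qed.

End Transition.

Lemma smooth_vfieldD X Y :
  smooth_vfield X -> smooth_vfield Y -> smooth_vfield (X + Y).
Proof.
move=> sX sY c catl k.
apply: (Ck_ext (@img_open _ _ _ c) _
  (CkD (@img_open _ _ _ c) (sX c catl k) (sY c catl k))).
by move=> u cu; rewrite /local_rep in_chartD//; exact: psi_dom.
Qed.

Lemma smooth_vfieldZ a X : smooth_vfield X -> smooth_vfield (a *: X).
Proof.
move=> sX c catl k.
apply: (Ck_ext (@img_open _ _ _ c) _ (CkZ a (@img_open _ _ _ c) (sX c catl k))).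
by move=> u cu; rewrite /local_rep in_chartZ//; exact: psi_dom.
Qed.

Lemma smooth_fun_cst a : @smooth_fun R n M (fun=> a).
Proof. by move=> c _ k; exact: Ck_cst. Qed.

Lemma apply_vfield_cst X a p : apply_vfield X (fun=> a) p = 0.
Proof. exact: derive_cst. Qed.

End SmoothFields.

(** * Connection and curvature in an orthonormal frame with constant brackets *)

Section LinearForm.
Context {R : pzRingType} {V : lmodType R} (f : V -> R).
Hypothesis f_lin : forall a u v, f (a *: u + v) = a * f u + f v.

Lemma lform0 : f 0 = 0.
Proof. by have := f_lin (-1) 0 0; rewrite scaler0 addr0 mulN1r addNr. Qed.

Lemma lformB u v : f (u - v) = f u - f v.
Proof. by rewrite addrC -scaleN1r f_lin mulN1r addrC. Qed.

Lemma lform_sum (I : finType) (a : I -> R) (v : I -> V) :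
  f (\sum_i a i *: v i) = \sum_i a i * f (v i).
Proof.
by elim/big_rec2 : _ => [|i y1 y2 _ <-]; [exact: lform0 | exact: f_lin].
Qed.

End LinearForm.

(** The right-hand side of Koszul's formula for an orthonormal frame, where only
the bracket terms survive. *)
Definition christoffel (R : realType) (n : nat) (c : 'I_n -> 'I_n -> 'I_n -> R)
    (i j k : 'I_n) : R :=
  (c i j k - c j k i + c k i j) / 2.

(** Each product of two Christoffel symbols comes from a second covariant
derivative of [x k], the outer derivative being moved to [x l] by metric
compatibility; this is why the summation index is last in both factors.  The
remaining terms come from the derivative along the bracket. *)
Definition frame_curvature (R : realType) (n : nat)
    (c : 'I_n -> 'I_n -> 'I_n -> R) (i j k l : 'I_n) : R :=
  let Gamma := christoffel c in
  \sum_m (Gamma i k m * Gamma j l m - Gamma j k m * Gamma i l m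
          - c i j m * Gamma m k l).

Definition frame_cov_deriv (R : realType) (n : nat)
    (c : 'I_n -> 'I_n -> 'I_n -> R) (s : 'I_n -> 'I_n -> R) (i j k : 'I_n) : R :=
  - \sum_m (christoffel c i j m * s m k + christoffel c i k m * s j m).

Section Symmetries.
Context {R : realType} {n : nat} (c : 'I_n -> 'I_n -> 'I_n -> R).
Hypothesis c_skew : forall i j k, c i j k = - c j i k.

Lemma christoffel_skew i j k : christoffel c i j k = - christoffel c i k j.
Proof.
by rewrite /christoffel (c_skew i k j) (c_skew k j i) (c_skew j i k); ring.
Qed.

Lemma frame_curvature_skewl i j k l :
  frame_curvature c i j k l = - frame_curvature c j i k l.
Proof.
rewrite /frame_curvature -sumrN; apply: eq_bigr => m _.
by rewrite (c_skew i j m); ring.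
Qed.

Lemma frame_curvature_skewr i j k l :
  frame_curvature c i j k l = - frame_curvature c i j l k.
Proof.
rewrite /frame_curvature -sumrN; apply: eq_bigr => m _.
by rewrite (christoffel_skew m k l); ring.
Qed.

End Symmetries.

Lemma frame_cov_deriv_sym (R : realType) (n : nat)
    (c : 'I_n -> 'I_n -> 'I_n -> R) (s : 'I_n -> 'I_n -> R) :
  (forall i j, s i j = s j i) ->
  forall i j k, frame_cov_deriv c s i j k = frame_cov_deriv c s i k j.
Proof.
move=> s_sym i j k; congr (- _); apply: eq_bigr => m _.
by rewrite addrC (s_sym j m) (s_sym m k).
Qed.

Lemma sum_vfieldE (R : realType) (n : nat) (M : manifoldType R n) (I : finType)
    (a : I -> R) (X : I -> vfield M) p :
  (\sum_i a i *: X i) p = \sum_i a i *: X i p.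
Proof. by rewrite fct_sumE. Qed.

(** The partial sums have to be smooth for additivity of the connection to
apply, so smoothness is carried along the induction. *)
Lemma connection_suml (R : realType) (n : nat) (M : manifoldType R n)
    (nabla : connection M) (I : finType) (a : I -> R) (X : I -> vfield M) Z :
  is_connection nabla -> (forall i, smooth_vfield (X i)) -> smooth_vfield Z ->
  nabla (\sum_i a i *: X i) Z = \sum_i a i *: nabla (X i) Z.
Proof.
move=> conn sX sZ.
have nablaZ b Y : smooth_vfield Y -> nabla (b *: Y) Z = b *: nabla Y Z.
  by move=> sY; exact: (connectionZl conn (smooth_fun_cst b) sY sZ).
suff [] : smooth_vfield (\sum_i a i *: X i) /\
  nabla (\sum_i a i *: X i) Z = \sum_i a i *: nabla (X i) Z by [].
elim/big_rec2 : _ => [|i Y1 Y2 _ [sY <-]].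
  split; first by rewrite -(scale0r Z); exact: smooth_vfieldZ.
  by rewrite -{1}(scale0r Z) nablaZ// scale0r.
have saX := smooth_vfieldZ (a i) (sX i).
split; first exact: smooth_vfieldD.
by rewrite (connectionDl conn saX sY sZ) (nablaZ _ _ (sX i)).
Qed.

Section OrthonormalFrame.
Context {R : realType} {n : nat} {M : manifoldType R n}.
Variables (g : tensor02 M) (nabla : connection M) (x : 'I_n -> vfield M).
Hypotheses (g_riem : is_riemannian g) (nabla_LC : is_levi_civita g nabla).
Hypothesis x_smooth : forall i, smooth_vfield (x i).
Hypothesis x_orthonormal : forall i j p, app02 g (x i) (x j) p = (i == j)%:R.

Let g_linl p w := fun a u v => metric_linear g_riem p a u v w.

(** Let [A] be the matrix whose rows are the frame vectors at [p].  Pairing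
[u *m A] with the frame gives back [u], so the square matrix [A] is
invertible. *)
Lemma frame_expansion p v : v = \sum_k g p v (x k p) *: x k p.
Proof.
pose A : 'M[R]_n := \matrix_(k < n) x k p.
have gA u j : g p (u *m A) (x j p) = u 0 j.
  rewrite mulmx_sum_row (lform_sum (g_linl p (x j p))).
  rewrite (bigD1 j)//= big1 => [|k kj]; rewrite rowK -/(app02 g _ _ p).
    by rewrite x_orthonormal eqxx mulr1 addr0.
  by rewrite x_orthonormal (negbTE kj) mulr0.
have A_free : row_free A.
  rewrite -kermx_eq0; apply/eqP/row_matrixP => k; rewrite row0.
  apply/rowP => j; rewrite -gA.
  have -> : row k (kermx A) *m A = 0 by rewrite -row_mul mulmx_ker row0.
  by rewrite (lform0 (g_linl p _)) mxE.
have /submxP[u ->] : (v <= A)%MS.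
  by rewrite submx_full// row_full_unit -row_free_unit.
rewrite {1}mulmx_sum_row; apply: eq_bigr => k _.
by rewrite gA rowK.
Qed.

Section ConstantStructure.
Variable c : 'I_n -> 'I_n -> 'I_n -> R.
Hypothesis x_bracket :
  forall i j, lie_bracket (x i) (x j) = \sum_k c i j k *: x k.

Let Gamma := christoffel c.

Lemma levi_civita_frame i j k p :
  app02 g (nabla (x i) (x j)) (x k) p = Gamma i j k.
Proof.
pose A i j k := app02 g (nabla (x i) (x j)) (x k) p.
have skew i' j' k' : A i' j' k' + A i' k' j' = 0.
  have /(congr1 (fun f => f p)) := levi_civita_metric nabla_LC
    (x_smooth i') (x_smooth j') (x_smooth k').
  have -> : app02 g (x j') (x k') = fun=> (j' == k')%:R.
    by apply/funext => q; exact: x_orthonormal.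
  rewrite apply_vfield_cst => /esym compat.
  have -> : A i' k' j' = app02 g (x j') (nabla (x i') (x k')) p.
    exact: Defs.metric_sym.
  exact: compat.
have torsion i' j' k' : A i' j' k' - A j' i' k' = c i' j' k'.
  have bracket : nabla (x i') (x j') p - nabla (x j') (x i') p =
      \sum_k c i' j' k *: x k p.
    by rewrite -sum_vfieldE -x_bracket -(levi_civita_torsion_free nabla_LC).
  rewrite /A /app02 -(lformB (g_linl p _)) bracket.
  rewrite (lform_sum (g_linl p _)) (bigD1 k')//= big1 => [|m mk].
    by rewrite -/(app02 g _ _ p) x_orthonormal eqxx mulr1 addr0.
  by rewrite -/(app02 g _ _ p) x_orthonormal (negbTE mk) mulr0.
rewrite -/(A i j k) /Gamma /christoffel -!torsion.
have := skew j i k; have := skew k i j; have := skew i j k.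
lra.
Qed.

Lemma levi_civita_expansion i j p :
  nabla (x i) (x j) p = \sum_k Gamma i j k *: x k p.
Proof.
rewrite [LHS](frame_expansion p); apply: eq_bigr => k _.
by rewrite -(levi_civita_frame i j k p).
Qed.

Lemma curvature_frame i j k l p :
  curvature04 g nabla (x i) (x j) (x k) (x l) p =
  frame_curvature c i j k l.
Proof.
have conn := levi_civita_connection nabla_LC.
(* [x i'] applied to the constant [g (nabla_(x j') (x k)) (x l)] is 0. *)
have second i' j' : g p (nabla (x i') (nabla (x j') (x k)) p) (x l p) =
    - \sum_m Gamma j' k m * Gamma i' l m.
  have /(congr1 (fun f => f p)) := levi_civita_metric nabla_LC
    (x_smooth i') (connection_smooth conn (x_smooth j') (x_smooth k))
    (x_smooth l).
  have -> : app02 g (nabla (x j') (x k)) (x l) = fun=> Gamma j' k l.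
    by apply/funext => q; exact: levi_civita_frame.
  rewrite apply_vfield_cst => /esym /eqP; rewrite addr_eq0 => /eqP.
  rewrite {1}/app02 => ->; congr (- _).
  rewrite /app02 levi_civita_expansion (lform_sum (g_linl p _)).
  apply: eq_bigr => m _; rewrite (Defs.metric_sym g_riem); congr (_ * _).
  exact: levi_civita_frame.
rewrite /curvature04 /app02 /curvature /frame_curvature.
rewrite !(lformB (g_linl p (x l p))) !second.
rewrite x_bracket connection_suml// sum_vfieldE (lform_sum (g_linl p _)).
rewrite opprK [- _ + _]addrC -!sumrB; apply: eq_bigr => m _.
by congr (_ - _ * _); exact: levi_civita_frame.
Qed.

Lemma cov_deriv_frame (h : tensor02 M) (s : 'I_n -> 'I_n -> R) :
  (forall p a u v w, h p (a *: u + v) w = a * h p u w + h p v w) ->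
  (forall p a u v w, h p w (a *: u + v) = a * h p w u + h p w v) ->
  (forall i j p, app02 h (x i) (x j) p = s i j) ->
  forall i j k p, cov_deriv nabla h (x i) (x j) (x k) p =
    frame_cov_deriv c s i j k.
Proof.
move=> h_linl h_linr hs i j k p; rewrite /cov_deriv.
have -> : app02 h (x j) (x k) = fun=> s j k.
  by apply/funext => q; exact: hs.
rewrite /GRing.add /GRing.opp /= apply_vfield_cst /app02.
rewrite !levi_civita_expansion.
rewrite (lform_sum (fun a u v => h_linl p a u v _)).
rewrite (lform_sum (fun a u v => h_linr p a u v _)).
rewrite sub0r -opprD -big_split /= /frame_cov_deriv.
congr (- _); apply: eq_bigr => m _.
by rewrite -!/(app02 h _ _ p) !hs.
Qed.

End ConstantStructure.
End OrthonormalFrame.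

(** * Dimension three *)

Lemma ord3P (i : 'I_3) : [\/ i = i1, i = i2 | i = i3].
Proof.
case: i => [[|[|[|//]]] ilt]; [constructor 1|constructor 2|constructor 3];
  exact: val_inj.
Qed.

Lemma big_ord3 (V : nmodType) (f : 'I_3 -> V) :
  \sum_i f i = f i1 + f i2 + f i3.
Proof.
by rewrite !big_ord_recl big_ord0 addr0 addrA; congr (f _ + f _ + f _);
  exact: val_inj.
Qed.

Lemma lie_bracketC (R : realType) (n : nat) (M : manifoldType R n)
    (X Y : vfield M) : lie_bracket X Y = - lie_bracket Y X.
Proof. by apply/funext => p; apply/esym; exact: opprB. Qed.

Lemma lie_bracketXX (R : realType) (n : nat) (M : manifoldType R n)
    (X : vfield M) : lie_bracket X X = 0.
Proof. by apply/funext => p; rewrite /lie_bracket subrr. Qed.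

(** [b12], [b23] and [b13] are the lists of coefficients of the brackets of
[x1, x2], of [x2, x3] and of [x1, x3]. *)
Definition structure_constants (R : realType) (b12 b23 b13 : seq R)
    (i j k : 'I_3) : R :=
  match val i, val j with
  | 0%N, 1%N => b12`_k | 1%N, 0%N => - b12`_k
  | 1%N, 2%N => b23`_k | 2%N, 1%N => - b23`_k
  | 0%N, 2%N => b13`_k | 2%N, 0%N => - b13`_k
  | _, _ => 0
  end.

Lemma structure_constants_skew (R : realType) (b12 b23 b13 : seq R) i j k :
  structure_constants b12 b23 b13 i j k =
  - structure_constants b12 b23 b13 j i k.
Proof.
by case: (ord3P i) => ->; case: (ord3P j) => ->;
  rewrite /structure_constants /= ?opprK ?oppr0.
Qed.

Lemma lie_bracket3 (R : realType) (n : nat) (M : manifoldType R n)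
    (x : 'I_3 -> vfield M) (b12 b23 b13 : seq R) :
  lie_bracket (x i1) (x i2) = \sum_(k < 3) b12`_k *: x k ->
  lie_bracket (x i2) (x i3) = \sum_(k < 3) b23`_k *: x k ->
  lie_bracket (x i1) (x i3) = \sum_(k < 3) b13`_k *: x k ->
  forall i j, lie_bracket (x i) (x j) =
    \sum_k structure_constants b12 b23 b13 i j k *: x k.
Proof.
have zero : 0 = \sum_(k < 3) (0 : R) *: x k.
  by rewrite big1 // => k _; rewrite scale0r.
have opp (b : seq R) : - (\sum_(k < 3) b`_k *: x k) = \sum_(k < 3) - b`_k *: x k.
  by rewrite -sumrN; apply: eq_bigr => k _; rewrite scaleNr.
move=> x12 x23 x13 i j.
by case: (ord3P i) => ->; case: (ord3P j) => ->;
  rewrite /structure_constants /= ?lie_bracketXX //;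
  rewrite lie_bracketC ?x12 ?x23 ?x13 opp.
Qed.

(** [lra] treats each monomial in the parameters as an unknown, so quadratic
relations in the context are used as linear equations. *)
Ltac frame_compute :=
  rewrite /frame_curvature /frame_cov_deriv !big_ord3 /christoffel
    /structure_constants /=; lra.

Section Family.
Context {R : realType} (l1 l2 l3 n1 n2 n3 : R).

Definition family_constants : 'I_3 -> 'I_3 -> 'I_3 -> R :=
  structure_constants [:: l1; l2; l3] [:: n1; n2; n3]
    [:: n2 + l3; n3 + l1; n1 + l2].

(** The cyclic sum of the curvature over its first three indices equals the
cyclic sum in the Jacobi identity, whose three components are, up to sign, the
left-hand sides of the hypotheses.  So the first Bianchi identity holds, and
with the two skew-symmetries it gives the exchange of pairs. *)
Lemma family_curvature_pair :
  2 * n1 * l2 + n1 ^+ 2 - l1 * n2 - n2 * n3 - l3 * n3 = 0 ->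
  2 * n2 * l3 + l3 ^+ 2 - l2 * n3 - l1 * l2 - l1 * n1 = 0 ->
  - l1 ^+ 2 + n3 ^+ 2 + l2 * l3 - n1 * n2 = 0 ->
  forall i j k l, frame_curvature family_constants i j k l =
                  frame_curvature family_constants k l i j.
Proof.
move=> jac1 jac2 jac3 i j k l; rewrite /family_constants.
by case: (ord3P i) => ->; case: (ord3P j) => ->; case: (ord3P k) => ->;
  case: (ord3P l) => ->; frame_compute.
Qed.

End Family.

Lemma assoc_metric_linearl (R : realType) (n : nat) (M : manifoldType R n)
    (g : tensor02 M) (Q : tensor11 M) :
  is_tensor11 Q -> is_riemannian g -> forall p a u v w,
  assoc_metric g Q p (a *: u + v) w =
  a * assoc_metric g Q p u w + assoc_metric g Q p v w.
Proof.
move=> Q_tensor g_riem p a u v w.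
by rewrite /assoc_metric (tensor11_linear Q_tensor) !(metric_linear g_riem); ring.
Qed.

Lemma assoc_metric_sym (R : realType) (n : nat) (M : manifoldType R n)
    (g : tensor02 M) (Q : tensor11 M) :
  is_riemannian g -> forall p v w,
  assoc_metric g Q p v w = assoc_metric g Q p w v.
Proof.
move=> g_riem p v w; rewrite /assoc_metric addrC.
by congr (_ + _); exact: Defs.metric_sym.
Qed.

Theorem proposition5p2 (R : realType) (G : lieGroupType R 3)
  (connected_G : connected [set: G])
  (x : 'I_3 -> vfield G) (x_basis : lie_algebra_basis x)
  (Q : tensor11 G) (Q_tensor : is_tensor11 Q) (Q_inv : left_invariant11 Q)
  (Q_x1 : app11 Q (x i1) = x i2)
  (Q_x2 : app11 Q (x i2) = x i3)
  (Q_x3 : app11 Q (x i3) = x i1)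
  (g : tensor02 G) (g_riem : is_riemannian g) (g_inv : left_invariant02 g)
  (g_x : forall i j p, app02 g (x i) (x j) p = (i == j)%:R)
  (nabla : connection G) (nabla_LC : is_levi_civita g nabla)
  (l1 l2 l3 n1 n2 n3 : R)
  (x12 : lie_bracket (x i1) (x i2) = l1 *: x i1 + l2 *: x i2 + l3 *: x i3)
  (x23 : lie_bracket (x i2) (x i3) = n1 *: x i1 + n2 *: x i2 + n3 *: x i3)
  (x13 : lie_bracket (x i1) (x i3) =
           (n2 + l3) *: x i1 + (n3 + l1) *: x i2 + (n1 + l2) *: x i3)
  (jac1 : 2 * n1 * l2 + n1 ^+ 2 - l1 * n2 - n2 * n3 - l3 * n3 = 0)
  (jac2 : 2 * n2 * l3 + l3 ^+ 2 - l2 * n3 - l1 * l2 - l1 * n1 = 0)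
  (jac3 : - l1 ^+ 2 + n3 ^+ 2 + l2 * l3 - n1 * n2 = 0)
  (p : G) :
  let Rm i j k l := curvature04 g nabla (x i) (x j) (x k) (x l) p in
  let F i j k := F_tensor g Q nabla (x i) (x j) (x k) p in
  let theta k := lee_theta g Q nabla x (x k) p in
  let theta_star k := lee_theta_star g Q nabla x (x k) p in
  (* curvature *)
  ([/\ Rm i1 i2 i1 i2 =
        - (1 / 4) * (l1 + n1 + n3) ^+ 2 + 3 / 4 * l3 ^+ 2 + l1 ^+ 2 + l2 ^+ 2
        + n2 * l3 + n2 ^+ 2 + 1 / 2 * l1 * l3 + 1 / 2 * n3 * l3
        - 1 / 2 * l3 * n1,
      Rm i1 i3 i1 i3 =
        3 / 4 * (l1 + n3) ^+ 2 - 1 / 4 * (l3 - n1) ^+ 2 + (l3 + n2) ^+ 2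
        + (l2 + n1) ^+ 2 + 1 / 2 * (l1 + n3) * (n1 + l3) - l1 * n3 &
      Rm i2 i3 i2 i3 =
        - (1 / 4) * l1 ^+ 2 + l2 ^+ 2 - 1 / 4 * l3 ^+ 2 + 3 / 4 * n1 ^+ 2
        + n2 ^+ 2 + 3 / 4 * n3 ^+ 2 + 1 / 2 * l1 * (- n3 + n1 - l3)
        - 1 / 2 * l3 * n3 + l2 * n1 - 1 / 2 * n1 * l3 + 1 / 2 * n1 * n3] /\
   [/\ Rm i1 i2 i2 i3 =
        - (l2 * l3) + l1 * n1 + l1 ^+ 2 + l1 * n3 + l3 * n3,
      Rm i1 i2 i1 i3 = l2 * (l1 + n1 + n3) + l3 * (l1 + l2 + n1) &
      Rm i1 i3 i3 i2 =
        - (l1 * n2) - n2 * n3 - l3 * n1 - n2 * l3 - n1 * n3 - n2 * n1] /\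
   (forall i j k l, [/\ Rm i j k l = - Rm j i k l,
                        Rm i j k l = - Rm i j l k &
                        Rm i j k l = Rm k l i j])) /\
  (* the tensor F *)
  ([/\ F i1 i1 i1 = 2 * l1 + 2 * l3 + 2 * n2,
      F i2 i2 i2 = - 2 * l2 + 2 * n2 &
      F i3 i3 i3 = - 2 * l2 - 2 * n1 - 2 * n3] /\
   [/\ F i1 i1 i2 = 1 / 2 * (l1 + l3 + n1 + 2 * n2 + n3),
      F i2 i2 i1 = 1 / 2 * (l1 + l3 + n1 + 2 * n2 + n3),
      F i1 i1 i3 = 1 / 2 * (l1 + l3 - n1 - n3) &
      F i3 i3 i1 = 1 / 2 * (l1 + l3 - n1 - n3)] /\
   [/\ F i2 i2 i3 = - (1 / 2) * (l1 + 2 * l2 + l3 + n1 + n3),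
      F i3 i3 i2 = - (1 / 2) * (l1 + 2 * l2 + l3 + n1 + n3),
      F i2 i1 i1 = l1 + 2 * l2 + l3 + n1 + n3 &
      F i3 i1 i1 = l1 + 2 * l2 + l3 + n1 + n3] /\
   [/\ F i1 i2 i2 = - l1 - l3 + n1 + n3,
      F i3 i2 i2 = - l1 - l3 + n1 + n3,
      F i1 i3 i3 = - l1 - l3 - n1 - 2 * n2 - n3 &
      F i2 i3 i3 = - l1 - l3 - n1 - 2 * n2 - n3] /\
   [/\ F i1 i2 i3 = - l1 - l3 - n2,
      F i2 i1 i3 = l2 - n2 &
      F i3 i1 i2 = l2 + n1 + n3] /\
   (forall i j k, F i j k = F i k j)) /\
  (* Lee forms *)
  ([/\ theta i1 = 3 * (l1 + l3 + n2),
      theta i2 = 3 * (n2 - l2) &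
      theta i3 = - 3 * (l2 + n1 + n3)] /\
   [/\ theta_star i1 = 3 / 2 * (l1 + 2 * l2 + l3 + n1 + n3),
      theta_star i2 = - (3 / 2) * (l1 + l3 - n1 - n3) &
      theta_star i3 = - (3 / 2) * (l1 + l3 + n1 + 2 * n2 + n3)]).
Proof.
move=> Rm F theta theta_star.
pose c := family_constants l1 l2 l3 n1 n2 n3.
have x_smooth i : smooth_vfield (x i) by exact: (x_basis.1 i).1.
have x_bracket i j : lie_bracket (x i) (x j) = \sum_k c i j k *: x k.
  by apply: lie_bracket3; rewrite big_ord3.
have RmE i j k l : Rm i j k l = frame_curvature c i j k l.
  exact: (curvature_frame g_riem nabla_LC x_smooth g_x x_bracket).
pose s i j : R := (i != j :> 'I_3)%:R.
have gtilde i j q : app02 (assoc_metric g Q) (x i) (x j) q = s i j.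
  have -> : app02 (assoc_metric g Q) (x i) (x j) q =
      app02 g (x i) (app11 Q (x j)) q + app02 g (app11 Q (x i)) (x j) q by [].
  by case: (ord3P i) => ->; case: (ord3P j) => ->;
    rewrite ?Q_x1 ?Q_x2 ?Q_x3 !g_x /s /= ?addr0 ?add0r.
have FE i j k : F i j k = frame_cov_deriv c s i j k.
  apply: (cov_deriv_frame g_riem nabla_LC x_smooth g_x x_bracket _ _ gtilde).
    exact: assoc_metric_linearl.
  move=> q a u v w; rewrite ![assoc_metric g Q q w _](assoc_metric_sym Q g_riem).
  exact: assoc_metric_linearl.
have thetaE k : theta k = F i1 i1 k + F i2 i2 k + F i3 i3 k.
  by rewrite /theta /lee_theta big_ord3.
have theta_starE k : theta_star k = F i1 i2 k + F i2 i3 k + F i3 i1 k.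
  by rewrite /theta_star /lee_theta_star big_ord3 Q_x1 Q_x2 Q_x3.
split; [split; [|split]|split].
- by split; rewrite RmE /c /family_constants; frame_compute.
- by split; rewrite RmE /c /family_constants; frame_compute.
- move=> i j k l; rewrite !RmE; split.
  + by apply: frame_curvature_skewl => ? ? ?; exact: structure_constants_skew.
  + by apply: frame_curvature_skewr => ? ? ?; exact: structure_constants_skew.
  + exact: family_curvature_pair.
- have s_sym i j : s i j = s j i by rewrite /s eq_sym.
  do 5![split; [by split; rewrite FE /c /s /family_constants; frame_compute|]].
  by move=> i j k; rewrite !FE; exact: frame_cov_deriv_sym.
- by split; split; rewrite ?thetaE ?theta_starE !FE /c /s /family_constants;
    frame_compute.
Qed.
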